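(* Let $n\ge 1$ be an integer, let $z_{n-1,1},\dots,z_{n-1,\frac12 n(n-1)}$ be the (distinct) complex roots of the Yablonskii--Vorob'ev polynomial $Q_{n-1}$ and let $z_{n,1},\dots,z_{n,\frac12 n(n+1)}$ be the (distinct) complex roots of $Q_n$. (i) For $1\leq j\leq \frac{1}{2}n(n-1)$: $$\sum_{k=1,\,k\neq j}^{\frac{1}{2}n(n-1)}\frac{1}{z_{n-1,j}-z_{n-1,k}}-\sum_{k=1}^{\frac{1}{2}n(n+1)}\frac{1}{z_{n-1,j}-z_{n,k}}=0,$$ $$\sum_{k=1,\,k\neq j}^{\frac{1}{2}n(n-1)}\frac{1}{(z_{n-1,j}-z_{n-1,k})^2}-\sum_{k=1}^{\frac{1}{2}n(n+1)}\frac{1}{(z_{n-1,j}-z_{n,k})^2}=\frac{z_{n-1,j}}{6},$$ $$\sum_{k=1,\,k\neq j}^{\frac{1}{2}n(n-1)}\frac{1}{(z_{n-1,j}-z_{n-1,k})^3}-\sum_{k=1}^{\frac{1}{2}n(n+1)}\frac{1}{(z_{n-1,j}-z_{n,k})^3}=-\frac{n+1}{4},$$ $$\sum_{k=1,\,k\neq j}^{\frac{1}{2}n(n-1)}\frac{1}{(z_{n-1,j}-z_{n-1,k})^5}-\sum_{k=1}^{\frac{1}{2}n(n+1)}\frac{1}{(z_{n-1,j}-z_{n,k})^5}=z_{n-1,j}\left(\frac{n+1}{24}-\frac{1}{36}\right).$$ (ii) For $1\leq j\leq \frac{1}{2}n(n+1)$: $$\sum_{k=1}^{\frac{1}{2}n(n-1)}\frac{1}{z_{n,j}-z_{n-1,k}}-\sum_{k=1,\,k\neq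 j}^{\frac{1}{2}n(n+1)}\frac{1}{z_{n,j}-z_{n,k}}=0,$$ $$\sum_{k=1}^{\frac{1}{2}n(n-1)}\frac{1}{(z_{n,j}-z_{n-1,k})^2}-\sum_{k=1,\,k\neq j}^{\frac{1}{2}n(n+1)}\frac{1}{(z_{n,j}-z_{n,k})^2}=-\frac{z_{n,j}}{6},$$ $$\sum_{k=1}^{\frac{1}{2}n(n-1)}\frac{1}{(z_{n,j}-z_{n-1,k})^3}-\sum_{k=1,\,k\neq j}^{\frac{1}{2}n(n+1)}\frac{1}{(z_{n,j}-z_{n,k})^3}=-\frac{n-1}{4},$$ $$\sum_{k=1}^{\frac{1}{2}n(n-1)}\frac{1}{(z_{n,j}-z_{n-1,k})^5}-\sum_{k=1,\,k\neq j}^{\frac{1}{2}n(n+1)}\frac{1}{(z_{n,j}-z_{n,k})^5}=z_{n,j}\left(\frac{n-1}{24}+\frac{1}{36}\right).$$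
   Context: The Yablonskii--Vorob'ev polynomials $Q_n$ ($n\ge 0$) are defined by $Q_0=1$, $Q_1=z$ and the differential-difference equation $Q_{n+1}Q_{n-1}=zQ_n^2-4\left(Q_nQ_n''-(Q_n')^2\right)$ for $n\ge1$, where $'$ denotes $d/dz$. It is known that each $Q_n$ is a monic polynomial in $z$ of degree $\frac12 n(n+1)$ with integer coefficients, and (Fukutani, Okamoto, Umemura) that all roots of $Q_n$ are simple and that $\gcd(Q_{n-1},Q_n)=1$ for $n\ge1$; hence $Q_m$ has exactly $\frac12 m(m+1)$ distinct complex roots, denoted $z_{m,k}$, $1\le k\le \frac12 m(m+1)$, and all denominators appearing are nonzero. Empty sums are $0$. *)

(* Defs.v *)
From mathcomp Require Import all_boot all_order all_algebra.
From mathcomp Require Import ring.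
From mathcomp Require Import reals.
From mathcomp Require Import complex.

Set Implicit Arguments.
Unset Strict Implicit.
Unset Printing Implicit Defensive.

Import GRing.Theory Num.Theory.
Local Open Scope ring_scope.

Definition toda (F : fieldType) (q : {poly F}) : {poly F} :=
  'X * q ^+ 2 - 4%:R * (q * q^`(2) - q^`() ^+ 2).

(* The Euclidean quotient is exact in characteristic 0: the recurrence
   Q_(n+1) * Q_(n-1) = z * Q_n ^ 2 - 4 * (Q_n * Q_n'' - Q_n' ^ 2)
   is lemma yv_rec below. *)
Fixpoint yv (F : fieldType) (n : nat) : {poly F} :=
  match n with
  | 0 => 1
  | m.+1 => match m with
            | 0 => 'X
            | k.+1 => toda (yv F m) %/ yv F k
            end
  end.

Definition enumerates_roots (F : fieldType) (p : {poly F}) (m : nat)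
    (z : 'I_m -> F) : Prop :=
  injective z /\ (forall x : F, root p x <-> exists k, z k = x).

(* yv_bilin2 and yv_bilin3 are the Hirota forms D^2 f.g and
   (D^3 - z D - n) f.g.  With w = (ln (f / g))', their vanishing amounts to
   (ln (f * g))'' = - w^2 and w'' = 2 w^3 + z w + n. *)
Definition yv_bilin2 (F : fieldType) (f g : {poly F}) : {poly F} :=
  f^`(2) * g - 2%:R * f^`() * g^`() + f * g^`(2).

Definition yv_bilin3 (F : fieldType) (n : nat) (f g : {poly F}) : {poly F} :=
  f^`(3) * g - 3%:R * f^`(2) * g^`() + 3%:R * f^`() * g^`(2) - f * g^`(3)
  - 'X * (f^`() * g - f * g^`()) - n%:R * f * g.

Lemma yv_step (F : numFieldType) (n : nat) (f g : {poly F}) :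
    coprimep f f^`() -> coprimep g g^`() ->
    yv_bilin2 f g = 0 -> yv_bilin3 n f g = 0 ->
  let h := toda g %/ f in
  [/\ h * f = toda g, coprimep h h^`(), yv_bilin2 g h = 0
    & yv_bilin3 n.+1 g h = 0].
Proof.
move=> cf cg B C h.
have natp_neq0 (k : nat) : (0 < k)%N -> k%:R != 0 :> {poly F}.
  by move=> k0; rewrite -polyC_natr polyC_eq0 pnatr_eq0 -lt0n.
have cop_nat (k : nat) (p q : {poly F}) :
    (0 < k)%N -> coprimep p (k%:R * q) = coprimep p q.
  move=> k0; rewrite -polyC_natr mul_polyC coprimepZr //.
  by rewrite pnatr_eq0 -lt0n.
have f0 : f != 0.
  by apply: contraTneq cf => ->; rewrite deriv0 /coprimep gcdp0 size_poly0.
pose k : {poly F} := (2 * n + 1)%N%:R.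
have dk : k^`() = 0 by rewrite /k -polyC_natr derivC.
have d2 : (2%:R : {poly F})^`() = 0 by rewrite -polyC_natr derivC.
have B' : f^`(3) * g - f^`(2) * g^`() - f^`() * g^`(2) + f * g^`(3) = 0.
  have := congr1 (@deriv F) B; rewrite /yv_bilin2 deriv0 !derivE => <-.
  by rewrite !derivSn !derivn0; ring.
have dN : (toda g)^`() = g ^+ 2 + 2%:R * 'X * g * g^`()
    - 4%:R * (g * g^`(3) - g^`() * g^`(2)).
  by rewrite /toda !derivE !derivSn !derivn0; ring.
have key : (toda g)^`() * f - 2%:R * toda g * f^`() = k * g ^+ 2 * f.
  apply/eqP; rewrite -subr_eq0; apply/eqP.
  transitivity (2%:R * g * (yv_bilin3 n f g -
      (f^`(3) * g - f^`(2) * g^`() - f^`() * g^`(2) + f * g^`(3)))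
      + 4%:R * g^`() * yv_bilin2 f g).
    by rewrite dN /toda /yv_bilin2 /yv_bilin3 /k; ring.
  by rewrite B B' C; ring.
have hf : h * f = toda g.
  apply: divpK; rewrite -(Gauss_dvdpl _ cf).
  have -> : toda g * f^`() = (2%:R^-1)%:P *
      ((toda g)^`() - k * g ^+ 2) * f.
    apply: (mulfI (natp_neq0 2%N isT)).
    transitivity ((toda g)^`() * f - k * g ^+ 2 * f); last first.
      rewrite !mulrA -[2%:R]polyC_natr -polyCM mulfV ?pnatr_eq0 //.
      by rewrite mul1r; ring.
    by rewrite -key; ring.
  exact: dvdp_mulIr.
have E : h^`() * f - h * f^`() = k * g ^+ 2.
  apply: (mulIf f0); rewrite -key -hf derivM; ring.
have E' : h^`(2) * f - h * f^`(2) = 2%:R * k * g * g^`().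
  have := congr1 (@deriv F) E; rewrite derivB expr2 !derivM dk !derivSn !derivn0.
  by move=> e; transitivity (h^`()^`() * f + h^`() * f^`()
    - (h^`() * f^`() + h * f^`()^`())); [ring | rewrite e; ring].
have E'' : h^`(3) * f + h^`(2) * f^`() - h^`() * f^`(2) - h * f^`(3)
    = 2%:R * k * (g^`() ^+ 2 + g * g^`(2)).
  have := congr1 (@deriv F) E'; rewrite derivB !derivM dk d2 !derivSn !derivn0.
  by move=> e; transitivity (h^`()^`()^`() * f + h^`()^`() * f^`()
    - (h^`() * f^`()^`() + h * f^`()^`()^`())); [ring | rewrite e; ring].
have chg : coprimep h g.
  rewrite coprimep_sym.
  have : coprimep g (h * f).
    have -> : h * f = ('X * g - 4%:R * g^`(2)) * g + 4%:R * g^`() ^+ 2.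
      by rewrite hf /toda; ring.
    by rewrite coprimep_addl_mul cop_nat // coprimep_expr.
  by rewrite coprimepMr => /andP[].
split=> //.
- have : coprimep h (h^`() * f).
    have -> : h^`() * f = f^`() * h + k * g ^+ 2.
      by rewrite -E; ring.
    by rewrite coprimep_addl_mul cop_nat ?addn1 // coprimep_expr.
  by rewrite coprimepMr => /andP[].
- apply: (mulIf f0); rewrite mul0r.
  transitivity (h * yv_bilin2 f g - 2%:R * g^`() *
    ((h^`() * f - h * f^`()) - k * g ^+ 2)
    + g * ((h^`(2) * f - h * f^`(2)) - 2%:R * k * g * g^`())).
    by rewrite /yv_bilin2; ring.
  by rewrite B E E'; ring.
- apply: (mulIf f0); apply: (mulIf f0); rewrite !mul0r.
  transitivity (- (h * f) * yv_bilin3 n f g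
    + k * g * f * (toda g - h * f) - k * g ^+ 2 * yv_bilin2 f g
    + (h^`() * f - h * f^`() - k * g ^+ 2)
       * (- 3%:R * f * g^`(2) - g * f^`(2) + 'X * f * g)
    + (h^`(2) * f - h * f^`(2) - 2%:R * k * g * g^`())
       * (3%:R * f * g^`() + g * f^`())
    - f * g * (h^`(3) * f + h^`(2) * f^`() - h^`() * f^`(2) - h * f^`(3)
        - 2%:R * k * (g^`() ^+ 2 + g * g^`(2)))).
    by rewrite /yv_bilin2 /yv_bilin3 /toda /k; ring.
  by rewrite hf E E' E'' B C; ring.
Qed.

Lemma yv_invariant (F : numFieldType) (n : nat) :
  let f := yv F n in let g := yv F n.+1 in
  [/\ coprimep f f^`(), coprimep g g^`(), yv_bilin2 f g = 0
    & yv_bilin3 n.+1 f g = 0].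
Proof.
elim: n => [|n [cf cg B C]] /=; last by have [_ ch B' C'] := yv_step cf cg B C.
rewrite /yv_bilin2 /yv_bilin3 !derivSn !derivn0.
rewrite -polyC1 !derivE ?coprimep1 ?coprime1p; split=> //; ring.
Qed.

Lemma yv_rec (F : numFieldType) (n : nat) (hn : (1 <= n)%N) :
  let Q := yv F in
  Q n.+1 * Q n.-1 =
    'X * Q n ^+ 2 - 4%:R * (Q n * (Q n)^`(2) - (Q n)^`() ^+ 2).
Proof.
case: n hn => // n _; have [cf cg B C] := yv_invariant F n.
by have [] := yv_step cf cg B C.
Qed.

(* Main.v *)
(* Put f = Q_(n-1) and g = Q_n.  The bilinear equations of [yv_invariant] say that
   w = (ln (f / g))' solves w'' = 2 w^3 + z w + n.  At a root x of f, w has the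
   Laurent expansion 1 / t + sum_i (-1)^i S_(i+1) t^i, t = z - x, where S_i are the
   differences of sums to be computed, and the equation determines S_1, S_2, S_3 and
   S_5 (the resonance leaves S_4 free).  Roots of g reduce to this case by
   exchanging f and g and replacing (w, n) by (- w, - n).  All expansions are
   congruences of polynomials modulo t^5. *)

Require Import Defs.
From mathcomp Require Import all_boot all_order all_algebra.
From mathcomp Require Import reals.
From mathcomp Require Import complex.
From mathcomp Require Import separable ring.

Import GRing.Theory Num.Theory.
Local Open Scope ring_scope.
Local Open Scope complex_scope.

(** * Root enumerations and truncated logarithmic derivatives *)

(** Coprimality with the derivative makes the list of roots in the splitting of [p] free of
    repetitions, hence a permutation of the values of [z]. *)
Lemma enumerates_roots_factorization (F : closedFieldType) (p : {poly F})
    (m : nat) (z : 'I_m -> F) :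
    enumerates_roots p z -> coprimep p p^`() ->
  lead_coef p != 0 /\ p = (lead_coef p)%:P * \prod_k ('X - (z k)%:P).
Proof.
move=> [z_inj z_root] sep.
have p0 : p != 0.
  by apply: contraTneq sep => ->; rewrite deriv0 /coprimep gcdp0 size_poly0.
have c0 : lead_coef p != 0 by rewrite lead_coef_eq0.
split=> //; have [r Dp] := closed_field_poly_normal p.
have r_uniq : uniq r.
  rewrite -separable_prod_XsubC separable_poly.unlock; move: sep.
  by rewrite {1 2}Dp derivZ coprimepZl // coprimepZr.
have r_root x : root p x = (x \in r).
  by rewrite Dp rootZ // root_prod_XsubC.
rewrite mul_polyC {1}Dp; congr (_ *: _).
have -> : \prod_k ('X - (z k)%:P) = \prod_(y <- [seq z k | k : 'I_m]) ('X - y%:P).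
  by rewrite big_image.
apply: perm_big.
apply: uniq_perm => // [|x]; first by rewrite map_inj_uniq ?enum_uniq.
rewrite -r_root; apply/idP/imageP => [/z_root[k <-]|[k _ ->]]; first by exists k.
by apply/z_root; exists k.
Qed.

(** The geometric series of [1 / ('X - y)] in powers of ['X - x], multiplied through by ['X - y] to
    stay among polynomials. *)
Lemma logderiv_XsubC_mod (F : fieldType) (x y : F) : x != y ->
  ('X - x%:P) ^+ 5 %| ('X - y%:P)^`() -
    ('X - y%:P) * \sum_(i < 5) ((-1) ^+ i / (x - y) ^+ i.+1) *: ('X - x%:P) ^+ i.
Proof.
move=> neq_xy; have d0 : x - y != 0 by rewrite subr_eq0.
set t := 'X - x%:P; set e := (x - y)^-1%:P.
have de : (x - y)%:P * e = 1 by rewrite -polyCM mulfV.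
have -> : 'X - y%:P = t + (x - y)%:P by rewrite /t polyCB; ring.
rewrite derivD derivC derivXsubC addr0.
under eq_bigr => i _.
  rewrite -mul_polyC polyCM polyC_exp polyCN polyC1 -exprVn polyC_exp -/e; over.
rewrite 5!big_ord_recl big_ord0 /= /bump /=.
(* With [s = t * e], [(1 + s) * (1 - s + s ^+ 2 - s ^+ 3 + s ^+ 4) = 1 + s ^+ 5], so the truncation
   error is [- e ^+ 5 * t ^+ 5]. *)
apply/dvdpP; exists (- e ^+ 5).
apply/eqP; rewrite -subr_eq0; apply/eqP.
transitivity ((1 - (x - y)%:P * e) *
  (1 - t * e + (t * e) ^+ 2 - (t * e) ^+ 3 + (t * e) ^+ 4)); first by ring.
by rewrite de subrr mul0r.
Qed.

(** A congruence [p' = p * A] makes [A] the truncated Taylor series of [p' / p] at [x]. Logarithmic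
    derivatives add up over products, so the geometric series of the linear factors sum to power
    sums. *)
Lemma logderiv_prod_mod (F : fieldType) (I : finType) (P : pred I)
    (z : I -> F) (c x : F) :
  let p := c%:P * \prod_(k | P k) ('X - (z k)%:P) in
  let S i := \sum_(k | P k) 1 / (x - z k) ^+ i in
    (forall k, P k -> x != z k) ->
  ('X - x%:P) ^+ 5 %| p^`() -
    p * \sum_(i < 5) ((-1) ^+ i * S i.+1) *: ('X - x%:P) ^+ i.
Proof.
move=> p S xz; set t := 'X - x%:P.
have -> : \sum_(i < 5) ((-1) ^+ i * S i.+1) *: t ^+ i =
    \sum_(k | P k) \sum_(i < 5) ((-1) ^+ i / (x - z k) ^+ i.+1) *: t ^+ i.
  rewrite exchange_big /=; apply: eq_bigr => i _.
  rewrite -scaler_suml mulr_sumr; congr (_ *: _).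
  by apply: eq_bigr => k _; rewrite div1r.
rewrite /p derivM derivC mul0r add0r -mulrA -mulrBr; apply: dvdp_mull.
have logderivM (p1 p2 A1 A2 : {poly F}) : t ^+ 5 %| p1^`() - p1 * A1 ->
    t ^+ 5 %| p2^`() - p2 * A2 -> t ^+ 5 %| (p1 * p2)^`() - p1 * p2 * (A1 + A2).
  move=> d1 d2; have -> : (p1 * p2)^`() - p1 * p2 * (A1 + A2) =
      (p1^`() - p1 * A1) * p2 + p1 * (p2^`() - p2 * A2).
    by rewrite derivM; ring.
  by apply: dvdp_add; [apply: dvdp_mulr | apply: dvdp_mull].
apply: (big_rec2 (fun A q => t ^+ 5 %| q^`() - q * A)) => [|k A q Pk].
  by rewrite -polyC1 derivC mulr0 subr0 dvdp0.
exact/logderivM/logderiv_XsubC_mod/xz.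
Qed.

(** Leibniz on [p * C], with [p'] replaced by [p * A]. Each differentiation costs one power of
    [t]. *)
Lemma deriv_logderiv_mod (F : fieldType) (k : nat) (x : F) (p q A C : {poly F}) :
  let t := 'X - x%:P in (k <= 5)%N ->
    t ^+ 5 %| p^`() - p * A -> t ^+ k.+1 %| q - p * C ->
  t ^+ k %| q^`() - p * (C^`() + A * C).
Proof.
move=> t k5 pA /dvdpP[r Dq].
have -> : q^`() - p * (C^`() + A * C) =
    (q - p * C)^`() + (p^`() - p * A) * C.
  by rewrite derivB derivM; ring.
rewrite dvdp_add //; last exact/dvdp_mulr/(dvdp_trans (dvdp_exp2l _ k5)).
rewrite Dq derivM deriv_exp derivXsubC mul1r /= -/t.
by rewrite dvdp_add ?dvdp_mull ?dvdp_exp2l // -mulr_natr dvdp_mulr.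
Qed.

(** * The Painlevé equation as a congruence at a root *)

Lemma dvdp_subM (F : fieldType) (d p p' q q' : {poly F}) :
  d %| p - p' -> d %| q - q' -> d %| p * q - p' * q'.
Proof.
move=> dp dq; have -> : p * q - p' * q' = (p - p') * q + p' * (q - q') by ring.
by apply: dvdp_add; [apply: dvdp_mulr | apply: dvdp_mull].
Qed.

(* With [f = t * p] and [w = (ln (f / g))' = 1 / t + U], this is
   [w'' = 2 w^3 + z w + c] multiplied by [t ^ 2]; [(ln (f * g))''] is eliminated
   through [yv_bilin2]. *)
Lemma painleve_mod (F : fieldType) (c x : F) (p g A B : {poly F}) :
  let t := 'X - x%:P in let U := A - B in
    ~~ root p x -> ~~ root g x ->
    t ^+ 5 %| p^`() - p * A -> t ^+ 5 %| g^`() - g * B ->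
    yv_bilin2 (t * p) g = 0 -> yv_bilin3 0 (t * p) g = c%:P * (t * p) * g ->
  t ^+ 5 %| 6%:R * U - t ^+ 2 * U^`(2) + 6%:R * t * U ^+ 2
    + 2%:R * t ^+ 2 * U ^+ 3 + 'X * (t + t ^+ 2 * U) + c%:P * t ^+ 2.
Proof.
move=> t U px gx pA gB e2 e3.
(* If [C] expands [q' / q], then [C' + C ^+ 2] expands [q'' / q], and [C'' + 3 C C' + C ^+ 3]
   expands [q''' / q]. *)
have logderivs (q C : {poly F}) : t ^+ 5 %| q^`() - q * C ->
    t ^+ 4 %| q^`(2) - q * (C^`() + C ^+ 2) /\
    t ^+ 3 %| q^`(3) - q * (C^`(2) + 3%:R * C * C^`() + C ^+ 3).
  move=> qC; have q2 : t ^+ 4 %| q^`(2) - q * (C^`() + C ^+ 2).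
    by rewrite expr2 [q^`(2)]derivSn derivn1; apply: deriv_logderiv_mod.
  split=> //; have := deriv_logderiv_mod _ 3 _ _ _ _ _ isT qC q2.
  rewrite derivnS derivD expr2 derivM.
  rewrite -[C^`()^`()]/(C^`(2)).
  by congr (_ %| _ - _ * _); ring.
have [p2 p3] := logderivs _ _ pA; have [g2 g3] := logderivs _ _ gB.
have dt : t^`() = 1 by rewrite derivXsubC.
have derivC1 : 1^`() = 0 :> {poly F} by rewrite -polyC1 derivC.
(* Expansions of the derivatives of [t * p] divided by [p]. The highest derivative of [p] always
   carries a factor [t], which regains one lost power. *)
have f0 : t ^+ 5 %| t * p - p * t by rewrite mulrC subrr dvdp0.
have f1 : t ^+ 5 %| (t * p)^`() - p * (1 + t * A).
  rewrite derivM dt (_ : _ - _ = t * (p^`() - p * A)); last by ring.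
  by rewrite dvdp_mull.
have f2 : t ^+ 5 %| (t * p)^`(2) - p * (2%:R * A + t * (A^`() + A ^+ 2)).
  rewrite [X in X - _](_ : _ = 2%:R * p^`() + t * p^`(2)); last first.
    by rewrite !derivSn !derivn0 !(dt, derivC1, derivM, derivD); ring.
  rewrite (_ : _ - _ = 2%:R * (p^`() - p * A) +
    t * (p^`(2) - p * (A^`() + A ^+ 2))); last by ring.
  by apply: dvdp_add; [apply: dvdp_mull | rewrite exprS; apply: dvdp_mul].
have f3 : t ^+ 4 %| (t * p)^`(3) - p * (3%:R * (A^`() + A ^+ 2) +
    t * (A^`(2) + 3%:R * A * A^`() + A ^+ 3)).
  rewrite [X in X - _](_ : _ = 3%:R * p^`(2) + t * p^`(3)); last first.
    by rewrite !derivSn !derivn0 !(dt, derivC1, derivM, derivD); ring.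
  rewrite (_ : _ - _ = 3%:R * (p^`(2) - p * (A^`() + A ^+ 2)) +
    t * (p^`(3) - p * (A^`(2) + 3%:R * A * A^`() + A ^+ 3))); last by ring.
  by apply: dvdp_add; [apply: dvdp_mull | rewrite exprS; apply: dvdp_mul].
have t54 (q : {poly F}) : t ^+ 5 %| q -> t ^+ 4 %| q.
  exact/dvdp_trans/dvdp_exp2l.
have g0 : t ^+ 5 %| g - g * 1 by rewrite mulr1 subrr dvdp0.
(* [M2] expands [yv_bilin2 (t * p) g] divided by [p * g]. Writing [A' + B' = U' + 2 B'] leaves [B']
   as the only term not in [U]. *)
pose M2 := 2%:R * U + t * (U^`() + U ^+ 2 + 2%:R * B^`()).
have m2 : t ^+ 5 %| p * g * M2.
  rewrite -dvdpNr (_ : - _ = yv_bilin2 (t * p) g - p * g * M2); last first.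
    by rewrite e2 sub0r.
  have tg2 : t ^+ 5 %| t * p * g^`(2) - t * p * (g * (B^`() + B ^+ 2)).
    by rewrite -mulrBr -[t * p * _]mulrA exprS dvdp_mul // dvdp_mull.
  rewrite (_ : _ - _ =
    ((t * p)^`(2) * g - p * (2%:R * A + t * (A^`() + A ^+ 2)) * (g * 1))
    - 2%:R * ((t * p)^`() * g^`() - p * (1 + t * A) * (g * B))
    + (t * p * g^`(2) - t * p * (g * (B^`() + B ^+ 2)))).
    apply: dvdp_add => //; apply: dvdp_sub; first exact: dvdp_subM.
    by apply: dvdp_mull; apply: dvdp_subM.
  by rewrite /yv_bilin2 /M2 /U derivB; ring.
(* Likewise for the cubic form minus [c * (t * p) * g]; third derivatives limit the precision to
   [t ^+ 4]. *)
pose M3 := 3%:R * (U^`() + U ^+ 2 + 2%:R * B^`()) + t * (U^`(2) + U ^+ 3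
   + 3%:R * U * U^`() + 6%:R * U * B^`()) - 'X * (1 + t * U) - c%:P * t.
have m3 : t ^+ 4 %| p * g * M3.
  rewrite -dvdpNr (_ : - _ = yv_bilin3 0 (t * p) g - c%:P * (t * p) * g
     - p * g * M3); last by rewrite e3 subrr sub0r.
  have tg3 : t ^+ 4 %| t * p * g^`(3)
      - t * p * (g * (B^`(2) + 3%:R * B * B^`() + B ^+ 3)).
    by rewrite -mulrBr -[t * p * _]mulrA exprS dvdp_mul // dvdp_mull.
  rewrite (_ : _ - _ =
    ((t * p)^`(3) * g - p * (3%:R * (A^`() + A ^+ 2) +
      t * (A^`(2) + 3%:R * A * A^`() + A ^+ 3)) * (g * 1))
    - 3%:R * ((t * p)^`(2) * g^`() - p * (2%:R * A + t * (A^`() + A ^+ 2)) * (g * B))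
    + 3%:R * ((t * p)^`() * g^`(2) - p * (1 + t * A) * (g * (B^`() + B ^+ 2)))
    - (t * p * g^`(3) - t * p * (g * (B^`(2) + 3%:R * B * B^`() + B ^+ 3)))
    - 'X * (((t * p)^`() * g - p * (1 + t * A) * (g * 1))
      - (t * p * g^`() - p * t * (g * B)))).
    apply: dvdp_sub; last first.
      apply: dvdp_mull; apply: dvdp_sub; first by apply: dvdp_subM; apply: t54.
      by apply: dvdp_subM; apply: t54.
    apply: dvdp_sub => //; apply: dvdp_add; last first.
      by apply: dvdp_mull; apply: dvdp_subM => //; apply: t54.
    apply: dvdp_sub; first by apply: dvdp_subM => //; apply: t54.
    by apply: dvdp_mull; apply: dvdp_subM; apply: t54.
  by rewrite /yv_bilin3 /M3 /U derivnB derivB; ring.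
have pg : coprimep (t ^+ 5) (p * g).
  by rewrite coprimep_expl // coprimepMr !(coprimep_sym t) !coprimep_XsubC px.
(* This combination cancels [B'], and the factor [t] lifts the congruence for [M3] to [t ^+ 5]. The
   factor [p * g] is invertible modulo [t ^+ 5]. *)
rewrite -(Gauss_dvdpr _ pg) [X in _ %| X](_ : _ =
  3%:R * (1 + t * U) * (p * g * M2) - t * (p * g * M3)); last first.
  by rewrite /M2 /M3; ring.
by apply: dvdp_sub; [apply: dvdp_mull | rewrite exprS; apply: dvdp_mul].
Qed.

(** * Solving for the Laurent coefficients *)

Lemma dvdp_XsubC_constD (F : fieldType) (k : nat) (x c : F) (q : {poly F}) :
  let t := 'X - x%:P in t ^+ k.+1 %| c%:P + t * q -> c = 0 /\ t ^+ k %| q.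
Proof.
move=> t tq; have c0 : c = 0.
  have : root (c%:P + t * q) x.
    by rewrite -dvdp_XsubCl; apply: dvdp_trans tq; rewrite exprS dvdp_mulr.
  by rewrite rootE !hornerE subrr mul0r addr0 => /eqP.
move: tq; rewrite c0 polyC0 add0r exprS dvdp_mul2l; first by split.
by rewrite polyXsubC_eq0.
Qed.

(** In the coefficient of [t ^+ i], [u i] enters linearly with factor [6 - i * (i - 1)]. This is
    nonzero for [i = 0, 1, 2, 4] and vanishes at the resonance [i = 3]. *)
Lemma painleve_laurent (F : numFieldType) (x c : F) (u : nat -> F) :
  let t := 'X - x%:P in let U := \sum_(i < 5) u i *: t ^+ i in
  t ^+ 5 %| 6%:R * U - t ^+ 2 * U^`(2) + 6%:R * t * U ^+ 2
    + 2%:R * t ^+ 2 * U ^+ 3 + 'X * (t + t ^+ 2 * U) + c%:P * t ^+ 2 ->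
  [/\ u 0%N = 0, u 1%N = - (x / 6%:R), u 2%N = - ((c + 1) / 4%:R) &
      u 4%N = x * ((c + 1) / 24%:R - 1 / 36%:R)].
Proof.
move=> t U.
have dt : t^`() = 1 by rewrite derivXsubC.
have derivC1 : 1^`() = 0 :> {poly F} by rewrite -polyC1 derivC.
pose Y := (u 2%N)%:P + t * ((u 3%N)%:P + t * (u 4%N)%:P).
pose V := (u 1%N)%:P + t * Y.
have DU : U = (u 0%N)%:P + t * V.
  by rewrite /U 5!big_ord_recl big_ord0 /= /bump /= -!mul_polyC /V /Y; ring.
have DU2 : U^`(2) = 2%:R * (u 2%N)%:P + 6%:R * t * (u 3%N)%:P
    + 12%:R * t ^+ 2 * (u 4%N)%:P.
  by rewrite DU /V /Y !derivSn derivn0 !(dt, derivC1, derivC, derivM, derivD); ring.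
have DX : 'X = x%:P + t by rewrite /t addrC subrK.
have nat_neq0 k : k.+1%:R != 0 :> F by rewrite pnatr_eq0.
rewrite DU2 {}DU DX.
rewrite [X in _ %| X](_ : _ = (6%:R * u 0%N)%:P + t *
  (6%:R * V - t * (2%:R * (u 2%N)%:P + 6%:R * t * (u 3%N)%:P + 12%:R * t ^+ 2 * (u 4%N)%:P)
  + 6%:R * ((u 0%N)%:P + t * V) ^+ 2 + 2%:R * t * ((u 0%N)%:P + t * V) ^+ 3
  + (x%:P + t) * (1 + t * ((u 0%N)%:P + t * V)) + c%:P * t)); last first.
  by rewrite polyCM polyC_natr; ring.
case/dvdp_XsubC_constD => /eqP; rewrite mulf_eq0 (negPf (nat_neq0 _)) /= => /eqP u0.
rewrite u0 polyC0 add0r => d4.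
have {d4} : t ^+ 4 %| (6%:R * u 1%N + x)%:P + t * ((4%:R * u 2%N + 1 + c)%:P
    + t * ((6%:R * u 1%N ^+ 2 + x * u 1%N)%:P
    + t * ((12%:R * u 1%N * u 2%N + x * u 2%N + u 1%N - 6%:R * u 4%N)%:P
    + t * ((12%:R * u 1%N + x)%:P * ((u 3%N)%:P + t * (u 4%N)%:P) + 6%:R * Y ^+ 2 + Y)))).
  (* Since now [U = t * V], the cubic term, after division by [t], is a multiple of [t ^+ 4] and
     drops out. *)
  rewrite -(dvdp_addl _ (dvdp_mulr (2%:R * V ^+ 3) (dvdpp (t ^+ 4)))).
  move: d4; congr (_ %| _).
  rewrite /V /Y !(polyCD, polyCB, polyCM, polyC_natr, polyC_exp, polyC1); ring.
case/dvdp_XsubC_constD => u1 /dvdp_XsubC_constD[u2].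
(* The discarded equation is the resonance: it reads [u 1 * (6 * u 1 + x) = 0], without [u 3]. *)
case/dvdp_XsubC_constD => _ /dvdp_XsubC_constD[u4 _].
have u1E : u 1%N = - (x / 6%:R).
  by rewrite -[LHS]subr0 -(mul0r 6%:R^-1) -u1; field; rewrite ?pnatr_eq0.
have u2E : u 2%N = - ((c + 1) / 4%:R).
  by rewrite -[LHS]subr0 -(mul0r 4%:R^-1) -u2; field; rewrite ?pnatr_eq0.
split=> //; rewrite -[LHS]addr0 -(mul0r 6%:R^-1) -u4 u1E u2E.
by field; rewrite ?pnatr_eq0.
Qed.

(** * Sums over the roots *)

(** Removing the factor of [f] at [x j] leaves [p]; the logarithmic derivatives of [p] and [g]
    differ by a series with coefficients [(-1) ^+ i * S i.+1]. The pair and [c] are arbitrary so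
    that the two polynomials can be exchanged. *)
Lemma yv_bilin_root_sums (F : numFieldType) (I J : finType) (x : I -> F)
    (y : J -> F) (lf lg c : F) (f g : {poly F}) (j : I) :
  f = lf%:P * \prod_k ('X - (x k)%:P) -> g = lg%:P * \prod_k ('X - (y k)%:P) ->
  injective x -> (forall k, x j != y k) -> lf != 0 -> lg != 0 ->
  yv_bilin2 f g = 0 -> yv_bilin3 0 f g = c%:P * f * g ->
  let S i := \sum_(k | k != j) 1 / (x j - x k) ^+ i
    - \sum_k 1 / (x j - y k) ^+ i in
  [/\ S 1%N = 0, S 2%N = x j / 6%:R, S 3%N = - ((c + 1) / 4%:R)
    & S 5%N = x j * ((c + 1) / 24%:R - 1 / 36%:R)].
Proof.
move=> Df Dg x_inj xy lf0 lg0 e2 e3 S.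
pose p := lf%:P * \prod_(k | k != j) ('X - (x k)%:P).
have Dfp : f = ('X - (x j)%:P) * p by rewrite Df (bigD1 j) //= /p; ring.
have xj k : k != j -> x j != x k by rewrite eq_sym; apply/contra_neq/x_inj.
have root_prod (K : finType) (P : pred K) (z : K -> F) (l : F) : l != 0 ->
    (forall k, P k -> x j != z k) ->
    ~~ root (l%:P * \prod_(k | P k) ('X - (z k)%:P)) (x j).
  move=> l0 zP; rewrite rootE hornerM hornerC horner_prod mulf_neq0 //.
  by apply/prodf_neq0 => k Pk; rewrite hornerXsubC subr_eq0 zP.
have := painleve_mod _ c (x j) p g _ _ (root_prod _ _ _ _ lf0 xj) _
  (logderiv_prod_mod _ _ _ _ _ _ xj) _ _ _.
rewrite -Dfp Dg; move/(_ _ (root_prod _ _ _ _ lg0 (fun k _ => xy k))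
  (logderiv_prod_mod _ _ _ _ _ _ (fun k _ => xy k))).
rewrite -Dg -sumrB => /(_ e2 e3).
under eq_bigr do rewrite -scalerBl -mulrBr -/(S _).
case/(painleve_laurent _ _ _ (fun i => (-1) ^+ i * S i.+1)); rewrite !exprS expr0 !mulr1 !mulN1r !opprK !mul1r.
by move=> S1 S2 S3 S5; split=> //; apply: oppr_inj; rewrite S2.
Qed.

(** The Hirota operator [D^3 - z D] is odd, so exchanging its arguments changes the sign. *)
Lemma yv_bilin3_sym (F : fieldType) (c : F) (f g : {poly F}) :
  yv_bilin3 0 f g = c%:P * f * g -> yv_bilin3 0 g f = (- c)%:P * g * f.
Proof.
move=> e; transitivity (- yv_bilin3 0 f g); first by rewrite /yv_bilin3; ring.
by rewrite e polyCN; ring.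
Qed.

Theorem theorem3 (R : realType) (n : nat) (hn : (1 <= n)%N)
    (a : 'I_(n * (n - 1) %/ 2) -> R[i])
    (b : 'I_(n * (n + 1) %/ 2) -> R[i])
    (ha : enumerates_roots (yv R[i] (n - 1)) a)
    (hb : enumerates_roots (yv R[i] n) b) :
  (forall j,
    [/\ \sum_(k | k != j) 1 / (a j - a k) - \sum_k 1 / (a j - b k) = 0,
        \sum_(k | k != j) 1 / (a j - a k) ^+ 2 - \sum_k 1 / (a j - b k) ^+ 2
          = a j / 6%:R,
        \sum_(k | k != j) 1 / (a j - a k) ^+ 3 - \sum_k 1 / (a j - b k) ^+ 3
          = - ((n%:R + 1) / 4%:R)
      & \sum_(k | k != j) 1 / (a j - a k) ^+ 5 - \sum_k 1 / (a j - b k) ^+ 5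
          = a j * ((n%:R + 1) / 24%:R - 1 / 36%:R)])
  /\
  (forall j,
    [/\ \sum_k 1 / (b j - a k) - \sum_(k | k != j) 1 / (b j - b k) = 0,
        \sum_k 1 / (b j - a k) ^+ 2 - \sum_(k | k != j) 1 / (b j - b k) ^+ 2
          = - (b j / 6%:R),
        \sum_k 1 / (b j - a k) ^+ 3 - \sum_(k | k != j) 1 / (b j - b k) ^+ 3
          = - ((n%:R - 1) / 4%:R)
      & \sum_k 1 / (b j - a k) ^+ 5 - \sum_(k | k != j) 1 / (b j - b k) ^+ 5
          = b j * ((n%:R - 1) / 24%:R + 1 / 36%:R)]).
Proof.
have [cf cg e2 e3] : let f := yv R[i] (n - 1) in let g := yv R[i] n in
    [/\ coprimep f f^`(), coprimep g g^`(), yv_bilin2 f g = 0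
      & yv_bilin3 0 f g = (n%:R)%:P * f * g].
  have := yv_invariant R[i] (n - 1); rewrite -[(n - 1).+1]addn1 subnK //.
  move=> [cf cg e2 e3]; split=> //; rewrite polyC_natr.
  by rewrite -[RHS]add0r -e3 /yv_bilin3; ring.
have [lf0 Df] := enumerates_roots_factorization _ _ _ _ ha cf.
have [lg0 Dg] := enumerates_roots_factorization _ _ _ _ hb cg.
have [a_inj a_root] := ha; have [b_inj b_root] := hb.
(* At a common root [yv_bilin2] reduces to [- 2 f' g'], which is nonzero because the roots of [f]
   and of [g] are simple. *)
have ab j k : a j != b k.
  apply/eqP => ajk; have fr : root (yv R[i] (n - 1)) (a j) by apply/a_root; exists j.
  have gr : root (yv R[i] n) (a j) by apply/b_root; exists k.
  have f'0 := coprimep_root cf fr; have g'0 := coprimep_root cg gr.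
  have /eqP := congr1 (horner^~ (a j)) e2.
  rewrite /yv_bilin2 !hornerE (rootP fr) (rootP gr) mulr0 mul0r addr0 sub0r.
  by rewrite oppr_eq0 -mulr2n !mulf_eq0 pnatr_eq0 (negPf f'0) (negPf g'0).
split=> j.
  by have [] := yv_bilin_root_sums _ _ _ _ _ _ _ _ _ _ j Df Dg a_inj (ab j) lf0 lg0 e2 e3.
have ba k : b j != a k by rewrite eq_sym.
have e2' : yv_bilin2 (yv R[i] n) (yv R[i] (n - 1)) = 0.
  by rewrite -e2 /yv_bilin2; ring.
have [S1 S2 S3 S5] := yv_bilin_root_sums _ _ _ _ _ _ _ _ _ _ j Dg Df b_inj ba
  lg0 lf0 e2' (yv_bilin3_sym _ _ _ _ e3).
(* The sums were obtained for the exchanged pair with [c = - n]; the differences in part (ii) are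
   their opposites. *)
split; apply: oppr_inj; rewrite opprB ?oppr0 ?opprK //.
- by rewrite S3; ring.
- by rewrite S5; ring.
Qed.
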